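(* Let $\Omega$ be a nonempty open subset of $\mathbb{R}^N$ that has infinite measure, let $p\in[1,+\infty)$ and let $\omega$ be an admissible weight function in $\Omega$. If there exists a constant $c>0$ such that $c\le\omega(x,y)$ for all $(x,y)\in\Omega\times\Omega$, then $$\mathcal{C}^\infty_c(\Omega)\cap W^{1,p}_\omega(\Omega)=\mathcal{C}^\infty_c(\Omega)\cap\mathrm{NLBV}_\omega(\Omega)=\{0\}.$$
   Context: An admissible weight function in $\Omega$ is a function $\omega:\Omega\times\Omega\to[0,+\infty)$ belonging to $\mathcal{C}^1(\Omega\times\Omega)$ with $\omega(x,y)=\omega(y,x)$ for all $(x,y)$. For $\psi\in\mathcal{C}^1_c(\Omega\times\Omega)$ and $i=1,\dots,N$ put $$\partial^*_{\omega,i}(\psi)(x):=\int_\Omega\frac{\partial}{\partial x_i}\left[\omega(x,y)(\psi(y,x)-\psi(x,y))\right]\mathrm{d}y,\quad x\in\Omega.$$ A function $u\in L^1_{\mathrm{loc}}(\Omega)$ has weak $i$-th nonlocal partial derivative $\partial_{\omega,i}u\in L^1_{\mathrm{loc}}(\Omega\times\Omega)$ if $$\int_\Omega u(x)\,\partial^*_{\omega,i}(\psi)(x)\,\mathrm{d}x=-\int_{\Omega\times\Omega}\partial_{\omega,i}u(x,y)\,\psi(x,y)\,\mathrm{d}x\,\mathrm{d}y\quad\text{for all }\psi\in\mathcal{C}^1_c(\Omega\times\Omega);$$ it is unique a.e. Put $\nabla_\omega u:=(\partial_{\omega,1}u,\dots,\partial_{\omega,N}u)$ and $W^{1,p}_\omega(\Omega):=\{u\in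 L^p(\Omega):\nabla_\omega u\in L^p(\Omega\times\Omega;\mathbb{R}^N)\}$. For $\phi=(\phi_1,\dots,\phi_N)\in\mathcal{C}^1_c(\Omega\times\Omega;\mathbb{R}^N)$, $\mathrm{div}_\omega(\phi):=\sum_{i=1}^N\partial^*_{\omega,i}(\phi_i)$. For $u\in L^1(\Omega)$, $\mathrm{NLTV}_\omega(u)$ is the supremum of $\int_\Omega u\,\mathrm{div}_\omega(\phi)\,\mathrm{d}x$ over all $\phi\in\mathcal{C}^1_c(\Omega\times\Omega;\mathbb{R}^N)$ whose pointwise Euclidean norm is at most $1$ everywhere, and $\mathrm{NLBV}_\omega(\Omega):=\{u\in L^1(\Omega):\mathrm{NLTV}_\omega(u)<+\infty\}$. *)

(* Defs.v *)
From HB Require Import structures.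
From mathcomp Require Import all_boot all_order all_algebra.
From mathcomp Require Import all_classical all_reals all_analysis.

Set Implicit Arguments.
Unset Strict Implicit.
Unset Printing Implicit Defensive.

Import Order.TTheory GRing.Theory Num.Theory.
Import numFieldNormedType.Exports.

Local Open Scope classical_set_scope.
Local Open Scope ring_scope.

(* The sigma-algebra on row vectors generated by the coordinates; over a
   realType it is the Borel sigma-algebra, as the topology of 'rV[R]_n is the
   product topology and R is second countable. *)
Definition measure_rV_display : measure_display.
Proof. exact: default_measure_display. Qed.

Section measurable_rV.
Context {R : realType} (n : nat).

Let coords (i : 'I_n) (x : 'rV[R]_n) : R := x ord0 i.

Let rV_set0 : g_sigma_preimage coords set0.
Proof. exact: sigma_algebra0. Qed.

Let rV_setC A : g_sigma_preimage coords A -> g_sigma_preimage coords (~` A).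
Proof. exact: sigma_algebraC. Qed.

Let rV_bigcup (F : _^nat) : (forall i, g_sigma_preimage coords (F i)) ->
  g_sigma_preimage coords (\bigcup_i (F i)).
Proof. exact: sigma_algebra_bigcup. Qed.

HB.instance Definition _ := @isMeasurable.Build measure_rV_display
  'rV[R]_n (g_sigma_preimage coords) rV_set0 rV_setC rV_bigcup.

End measurable_rV.

Lemma measurable_coord (R : realType) n (i : 'I_n) :
  measurable_fun [set: 'rV[R]_n] (fun x => x ord0 i).
Proof.
move=> _ Y mY; rewrite setTI; apply: sub_sigma_algebra => /=.
rewrite -bigcup_seq/=; exists i => /=; first by rewrite mem_index_enum.
by exists Y => //; rewrite setTI.
Qed.

Lemma measurable_fun_rV d (T : measurableType d) (R : realType) n
    (f : T -> 'rV[R]_n) :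
  (forall i, measurable_fun setT (fun x => f x ord0 i)) ->
  measurable_fun setT f.
Proof.
move=> mf; suff fS : g_sigma_preimage (fun i => (fun x : 'rV[R]_n => x ord0 i) \o f)
    `<=` measurable.
  rewrite g_sigma_preimage_comp in fS.
  by move=> _ A mA; apply: fS; exists A.
apply: smallest_sub; first exact: sigma_algebra_measurable.
case: n f mf => [|n] f mf; first by rewrite big_ord0.
rewrite -bigcup_mkord_ord; apply: bigcup_sub => i Ii.
by move=> A [B mB <-]; exact: mf.
Qed.

Section lebesgue_rV.
Context {R : realType}.
Local Open Scope ereal_scope.

Definition row_cons n (z : R * 'rV[R]_n) : 'rV[R]_n.+1 :=
  (\row_i (if unlift ord0 i is Some j then z.2 ord0 j else z.1))%R.

Definition row_uncons n (x : 'rV[R]_n.+1) : R * 'rV[R]_n :=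
  (x ord0 ord0, \row_j x ord0 (lift ord0 j))%R.

Lemma row_consK n : cancel (@row_cons n) (@row_uncons n).
Proof.
case=> a v; rewrite /row_uncons /row_cons/=; congr pair.
  by rewrite mxE unlift_none.
by apply/rowP => j; rewrite !mxE liftK.
Qed.

Lemma row_unconsK n : cancel (@row_uncons n) (@row_cons n).
Proof.
move=> x; apply/rowP => i; rewrite mxE.
by case: unliftP => [j ->|->] /=; rewrite ?mxE.
Qed.

Lemma measurable_row_cons n : measurable_fun setT (@row_cons n).
Proof.
apply: measurable_fun_rV => i; rewrite /row_cons.
under eq_fun do rewrite mxE.
case: unliftP => [j _|_]; last exact: measurable_fst.
apply: (measurableT_comp (@measurable_coord R n j)); exact: measurable_snd.
Qed.

Lemma measurable_row_uncons n : measurable_fun setT (@row_uncons n).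
Proof.
apply: measurable_fun_pair; first exact: measurable_coord.
apply: measurable_fun_rV => j; under eq_fun do rewrite mxE.
exact: measurable_coord.
Qed.

Section lebesgue_cons.
Variables (n : nat) (nu : {sigma_finite_measure set 'rV[R]_n -> \bar R}).

Definition lebesgue_cons : set 'rV[R]_n.+1 -> \bar R :=
  pushforward (@lebesgue_measure R \x nu) (@row_cons n).

Let lebesgue_cons0 : lebesgue_cons set0 = 0.
Proof. apply: measure0; exact: measurable_row_cons. Qed.

Let lebesgue_cons_ge0 A : 0 <= lebesgue_cons A.
Proof. apply: measure_ge0; exact: measurable_row_cons. Qed.

Let lebesgue_cons_sigma_additive : semi_sigma_additive lebesgue_cons.
Proof. apply: measure_semi_sigma_additive; exact: measurable_row_cons. Qed.

HB.instance Definition _ := isMeasure.Build _ _ _ lebesgue_cons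
  lebesgue_cons0 lebesgue_cons_ge0 lebesgue_cons_sigma_additive.

Let lebesgue_cons_sigma_finite : sigma_finite setT lebesgue_cons.
Proof.
have /sigma_finiteP[F [TF ndF Foo]] := sigma_finiteT (@lebesgue_measure R).
have /sigma_finiteP[G [TG ndG Goo]] := sigma_finiteT nu.
exists (fun k => @row_uncons n @^-1` (F k `*` G k)).
  rewrite -preimage_bigcup -(preimage_setT (@row_uncons n)); congr (_ @^-1` _).
  rewrite -setXTT TF TG predeqE => -[x y]; split.
    move=> [/= [i _ Fix] [k _ Gky]]; exists (maxn i k) => //; split.
    - by move: x Fix; exact/subsetPset/ndF/leq_maxl.
    - by move: y Gky; exact/subsetPset/ndG/leq_maxr.
  by move=> [i _ []/= ? ?]; split; exists i.
move=> k; have [mF Fk] := Foo k; have [mG Gk] := Goo k; split.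
  rewrite -[X in measurable X]setTI; apply: measurable_row_uncons => //.
  exact: measurableX.
rewrite /lebesgue_cons /pushforward -comp_preimage.
have -> : @row_uncons n \o @row_cons n = id.
  by apply/funext => z /=; rewrite row_consK.
by rewrite preimage_id product_measure1E// lte_mul_pinfty// ge0_fin_numE.
Qed.

HB.instance Definition _ := @Measure_isSigmaFinite.Build _ _ _ lebesgue_cons
  lebesgue_cons_sigma_finite.

End lebesgue_cons.

Fixpoint lebesgue_rV n : {sigma_finite_measure set 'rV[R]_n -> \bar R} :=
  match n with
  | 0%N => \d_(0%R : 'rV[R]_0)
  | n'.+1 => lebesgue_cons (lebesgue_rV n')
  end.

End lebesgue_rV.
Arguments lebesgue_rV : clear implicits.

(* A function on an open set U is represented by a total function, whose values
   outside U are irrelevant; differentiability at a point of U is local. In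
   finite dimension, continuity of all the directional derivatives amounts to
   continuity of the partial ones. *)
Fixpoint Ck {R : realType} {V W : normedModType R} (k : nat) (U : set V)
    (f : V -> W) : Prop :=
  match k with
  | 0%N => forall x, U x -> {for x, continuous f}
  | k'.+1 => (forall x, U x -> differentiable f x) /\
             (forall v, Ck k' U ('D_v f))
  end.

Definition Cinfty {R : realType} {V W : normedModType R} (U : set V)
  (f : V -> W) : Prop := forall k, Ck k U f.

(* Compactly supported functions are identified with their extension by 0. *)
Definition compactly_supported {R : realType} {V W : normedModType R}
    (U : set V) (f : V -> W) : Prop :=
  exists K, [/\ compact K, K `<=` U & forall x, ~ K x -> f x = 0].

Definition C1c {R : realType} {V W : normedModType R} (U : set V) :
  set (V -> W) := [set f | Ck 1 U f /\ compactly_supported U f].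

Definition Cc_infty {R : realType} {V W : normedModType R} (U : set V) :
  set (V -> W) := [set f | Cinfty U f /\ compactly_supported U f].

Definition enorm {R : realType} n (v : 'rV[R]_n) : R :=
  Num.sqrt (\sum_i v ord0 i ^+ 2).

Section function_spaces.
Context d (T : measurableType d) (R : realType).
Variable mu : {measure set T -> \bar R}.

Definition Lp (p : R) (D : set T) : set (T -> R) :=
  [set f : T -> R | measurable_fun D f /\
           (\int[mu]_(x in D) (`|f x| `^ p)%:E < +oo)%E].

Definition Lp_rV n (p : R) (D : set T) : set (T -> 'rV[R]_n) :=
  [set f : T -> 'rV[R]_n | measurable_fun D f /\
           (\int[mu]_(x in D) (enorm (f x) `^ p)%:E < +oo)%E].

End function_spaces.

Section nonlocal.
Context {R : realType} {N : nat}.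
Local Notation V := 'rV[R]_N.
Variable Omega : set V.

Local Notation leb := (lebesgue_rV R N).
Local Notation leb2 := (leb \x leb)%E.
Local Notation Omega2 := (Omega `*` Omega).

Definition L1loc (u : V -> R) : Prop :=
  measurable_fun Omega u /\
  forall K, compact K -> K `<=` Omega -> leb.-integrable K (EFin \o u).

Definition L1loc2 (g : V * V -> R) : Prop :=
  measurable_fun Omega2 g /\
  forall K, compact K -> K `<=` Omega2 -> leb2.-integrable K (EFin \o g).

Definition admissible_weight (omega : V * V -> R) : Prop :=
  [/\ forall x y, Omega x -> Omega y -> 0 <= omega (x, y),
      Ck 1 Omega2 omega &
      forall x y, Omega x -> Omega y -> omega (x, y) = omega (y, x)].

Variable omega : V * V -> R.

Definition nl_adjoint (i : 'I_N) (psi : V * V -> R) (x : V) : R :=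
  \int[leb]_(y in Omega)
    'D_(delta_mx ord0 i : V)
      (fun x' : V => omega (x', y) * (psi (y, x') - psi (x', y))) x.

Definition is_weak_nl_partial (i : 'I_N) (u : V -> R) (g : V * V -> R) : Prop :=
  [/\ L1loc u, L1loc2 g &
      forall psi : V * V -> R, C1c Omega2 psi ->
        \int[leb]_(x in Omega) (u x * nl_adjoint i psi x) =
        - \int[leb2]_(z in Omega2) (g z * psi z)].

Definition is_weak_nl_gradient (u : V -> R) (g : V * V -> V) : Prop :=
  forall i, is_weak_nl_partial i u (fun z => g z ord0 i).

Definition W1p (p : R) : set (V -> R) :=
  [set u | Lp leb p Omega u /\
           exists2 g, is_weak_nl_gradient u g & Lp_rV leb2 p Omega2 g].

Definition nl_div (phi : V * V -> V) (x : V) : R :=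
  \sum_(i < N) nl_adjoint i (fun z => phi z ord0 i) x.

Definition NLTV (u : V -> R) : \bar R :=
  ereal_sup [set (\int[leb]_(x in Omega) (u x * nl_div phi x))%:E |
    phi in [set phi : V * V -> V | C1c Omega2 phi /\
                                   forall z, enorm (phi z) <= 1]].

Definition NLBV : set (V -> R) :=
  [set u | leb.-integrable Omega (EFin \o u) /\ (NLTV u < +oo)%E].

End nonlocal.

(* Main.v *)
Require Import Defs.
From mathcomp Require Import all_boot all_order all_algebra.
From mathcomp Require Import all_classical all_reals all_analysis.
From mathcomp Require Import measurable_realfun lra.

Set Implicit Arguments.
Unset Strict Implicit.
Unset Printing Implicit Defensive.

Import Order.TTheory GRing.Theory Num.Theory.
Import numFieldNormedType.Exports.

Local Open Scope classical_set_scope.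
Local Open Scope ring_scope.

(** The reason is that a test function may spread over a set of infinite measure
    while u only sees one bounded region. Let u be a compactly supported smooth
    function that is not zero, with support K, and let D be the derivative in
    the first coordinate direction. Since u is not zero but vanishes far away,
    D u is positive somewhere, hence at least some d > 0 on an open subset U of
    Omega. Take psi (x, y) := a x * b y, where a is a bump supported in U and b,
    with values in [0, 1], is compactly supported in Omega minus K. On the
    support of u the terms psi (y, x) vanish, so Fubini and an integration by
    parts in x give

      int u * nl_adjoint psi = int int D u x * omega (x, y) * a x * b y
                            >= c * d * int int psi,

    the term D u y of the general formula being killed by b. This is
    [integral_nl_adjoint] and [large_test_functions]. As Omega minus K still has
    infinite measure, b can be chosen with an arbitrarily large integral
    ([exists_large_bump]), while 0 <= psi <= 1.

    For NLBV this says that the supremum defining NLTV u is infinite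
    ([NLBV_C1c_eq0]). For W1p, let g be the weak gradient and k := c * d. By
    [mul_le_powR] with threshold t := k / 2, the product |g| * psi is at most
    t * psi + t ^ (1 - p) * |g| ^ p pointwise, so that

      k * int psi <= |int g * psi| <= (k / 2) * int psi + const,

    which bounds int psi, a contradiction ([W1p_C1c_eq0]).

    Dimension 0 is excluded because there Omega has measure at most 1. *)

(** * Calculus of C^1 functions *)

Section Ck_general.
Context {R : realType}.

Lemma Ck_cst k (V W : normedModType R) (U : set V) (c : W) :
  Ck k U (fun _ : V => c).
Proof.
elim: k c => [|k IH] c /=; first by move=> x _; exact: cst_continuous.
split=> [x _|v]; first exact: differentiable_cst.
rewrite (_ : 'D_v (fun=> c) = cst 0); first exact: IH.
by apply/funext => y; rewrite derive_cst.
Qed.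

Lemma Ck_sub k (V W : normedModType R) (U U' : set V) (f : V -> W) :
  U' `<=` U -> Ck k U f -> Ck k U' f.
Proof.
move=> UU; elim: k f => [|k IH] f /=; first by move=> cf x /UU; exact: cf.
by move=> [df Df]; split=> [x /UU|v]; [exact: df|exact: IH].
Qed.

(** As for sums and products below, U being open makes the formula for the
    derivative valid in a neighbourhood of each point of U, which is what
    continuity of the derivative at that point requires. *)
Lemma Ck1_scalel (V W : normedModType R) (U : set V) (f : V -> R) (w : W) :
  open U -> Ck 1 U f -> Ck 1 U (fun x => f x *: w).
Proof.
move=> oU Cf; split=> [x Ux|v x Ux].
  by apply: differentiableZl; exact: Cf.1.
have DE : \forall y \near x, 'D_v f y *: w = 'D_v (fun x => f x *: w) y.
  near=> y; have Uy : U y by near: y; exact: open_nbhs_nbhs.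
  have df : differentiable f y by exact: Cf.1.
  rewrite [RHS]deriveE; last exact: differentiableZl.
  by rewrite diffZl//= deriveE.
rewrite /prop_for /continuous_at -(nbhs_singleton DE).
apply: cvg_trans; first exact: near_eq_cvg DE.
by apply: cvgZr_tmp; exact: Cf.2.
Unshelve. all: by end_near. Qed.

End Ck_general.

Section calculus.
Context {R : realType} {V : normedModType R}.
Implicit Types (U K : set V) (f g : V -> R).

Lemma Ck1_continuous U f x : Ck 1 U f -> U x -> {for x, continuous f}.
Proof. by case=> df _ Ux; apply: differentiable_continuous; exact: df. Qed.

Lemma Ck1_derivable U f x v : Ck 1 U f -> U x -> derivable f x v.
Proof. by case=> df _ Ux; apply: diff_derivable; exact: df. Qed.

Lemma Ck1_mul U f g : open U -> Ck 1 U f -> Ck 1 U g ->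
  Ck 1 U (fun x => f x * g x).
Proof.
move=> oU Cf Cg; split=> [x Ux|v x Ux].
  by apply: differentiableM; [exact: Cf.1|exact: Cg.1].
have DE : \forall y \near x, f y * 'D_v g y + g y * 'D_v f y
    = 'D_v (fun x => f x * g x) y.
  near=> y; have Uy : U y by near: y; exact: open_nbhs_nbhs.
  by rewrite [RHS]deriveM//; [exact: (Ck1_derivable Cf)
    |exact: (Ck1_derivable Cg)].
rewrite /prop_for /continuous_at -(nbhs_singleton DE).
apply: cvg_trans; first exact: near_eq_cvg DE.
have cf : f @ x --> f x := Ck1_continuous Cf Ux.
have cg : g @ x --> g x := Ck1_continuous Cg Ux.
have cDf : 'D_v f @ x --> 'D_v f x := Cf.2 v x Ux.
have cDg : 'D_v g @ x --> 'D_v g x := Cg.2 v x Ux.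
exact: cvgD (cvgM cf cDg) (cvgM cg cDf).
Unshelve. all: by end_near. Qed.

Lemma Ck1_add U f g : open U -> Ck 1 U f -> Ck 1 U g ->
  Ck 1 U (fun x => f x + g x).
Proof.
move=> oU Cf Cg; split=> [x Ux|v x Ux].
  by apply: differentiableD; [exact: Cf.1|exact: Cg.1].
have DE : \forall y \near x, 'D_v f y + 'D_v g y
    = 'D_v (fun x => f x + g x) y.
  near=> y; have Uy : U y by near: y; exact: open_nbhs_nbhs.
  by rewrite [RHS]deriveD//; [exact: (Ck1_derivable Cf)
    |exact: (Ck1_derivable Cg)].
rewrite /prop_for /continuous_at -(nbhs_singleton DE).
apply: cvg_trans; first exact: near_eq_cvg DE.
have cDf : 'D_v f @ x --> 'D_v f x := Cf.2 v x Ux.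
have cDg : 'D_v g @ x --> 'D_v g x := Cg.2 v x Ux.
exact: cvgD cDf cDg.
Unshelve. all: by end_near. Qed.

Lemma Ck1_sum U I (r : seq I) (F : I -> V -> R) : open U ->
  (forall i, Ck 1 U (F i)) -> Ck 1 U (fun x => \sum_(i <- r) F i x).
Proof.
move=> oU CF; elim: r => [|i r IH].
  by under eq_fun do rewrite big_nil; exact: Ck_cst.
by under eq_fun do rewrite big_cons; exact: (Ck1_add oU (CF i) IH).
Qed.

Lemma Ck1_prod U I (r : seq I) (F : I -> V -> R) : open U ->
  (forall i, Ck 1 U (F i)) -> Ck 1 U (fun x => \prod_(i <- r) F i x).
Proof.
move=> oU CF; elim: r => [|i r IH].
  by under eq_fun do rewrite big_nil; exact: Ck_cst.
by under eq_fun do rewrite big_cons; exact: (Ck1_mul oU (CF i) IH).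
Qed.

Lemma Ck1_comp (phi dphi : R -> R) f :
  (forall s : R, is_derive s 1 phi (dphi s)) -> continuous dphi ->
  Ck 1 setT f -> Ck 1 setT (fun x => phi (f x)).
Proof.
move=> Dphi cdphi Cf.
have dphi_diff s : differentiable phi s by apply/derivable1_diffP.
have df x : differentiable f x by exact: Cf.1.
split=> [x _|v x _]; first by apply: differentiable_comp.
rewrite (_ : 'D_v _ = fun x => 'D_v f x * dphi (f x)); last first.
  apply/funext => y; rewrite [LHS]deriveE; last exact: differentiable_comp.
  rewrite diff_comp//= (deriveE _ (df y)) (diff1E (dphi_diff _)) derive1E.
  by have [_ ->] := Dphi (f y).
apply: cvgM; first exact: Cf.2.
apply: (@continuous_comp _ _ _ f dphi); last exact: cdphi.
exact: differentiable_continuous.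
Qed.

(** The increments of f \o A along v are increments of f along L v, so the
    derivative of the composite is read off the definition of 'D_v. *)
Lemma Ck1_comp_affine (W : normedModType R) (A L : W -> V) f :
  (forall x, differentiable A x) ->
  (forall (h : R) v x, A (h *: v + x) = h *: L v + A x) ->
  Ck 1 setT f -> Ck 1 setT (fun x => f (A x)).
Proof.
move=> dA AL Cf; split=> [x _|v x _].
  by apply: differentiable_comp => //; exact: Cf.1.
rewrite (_ : 'D_v _ = 'D_(L v) f \o A); last first.
  apply/funext => y; rewrite /derive/=.
  by under eq_fun do rewrite AL.
apply: continuous_comp; last exact: Cf.2.
exact: differentiable_continuous.
Qed.

Lemma C1c_mull U f g : open U -> Ck 1 U f -> C1c U g ->
  C1c U (fun x => f x * g x).
Proof.
move=> oU Cf [Cg [K [cK KU gK]]]; split; first exact: Ck1_mul.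
by exists K; split=> // x /gK ->; rewrite mulr0.
Qed.

Lemma near_notin_compact K x : compact K -> ~ K x -> \forall y \near x, ~ K y.
Proof.
move=> cK nKx; apply: (open_nbhs_nbhs (A := ~` K)); split=> //.
by apply: closed_openC; apply: compact_closed.
Qed.

Lemma compact_support_near0 K f x : compact K -> (forall x, ~ K x -> f x = 0) ->
  ~ K x -> \forall y \near x, f y = 0.
Proof.
move=> cK fK nKx; near=> y; apply: fK; near: y; exact: near_notin_compact.
Unshelve. all: by end_near. Qed.

Lemma derive_compact_support K f v x : compact K ->
  (forall x, ~ K x -> f x = 0) -> ~ K x -> 'D_v f x = 0.
Proof.
move=> cK fK nKx.
rewrite (@near_eq_derive _ _ _ f (cst 0)); first by rewrite derive_cst.
exact: compact_support_near0 fK nKx.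
Qed.

(** Global classes, with no reference to the open set where the function lives:
    [Cc] is C_c^0 and [Cc1] is C_c^1 on the whole space, with differentiability
    replaced by derivability in each direction. Directional derivatives pass to
    slices and products by mere computation of the increments. *)
Definition Cc f := continuous f /\
  exists2 K, compact K & forall x, ~ K x -> f x = 0.

Definition Cc1 f := [/\ Cc f, forall x v, derivable f x v &
  forall v, Cc ('D_v f)].

(** The extension by 0 is as regular outside the compact support as inside,
    since it vanishes on the open complement of that support. *)
Lemma C1c_Cc1 U f : C1c U f -> Cc1 f.
Proof.
move=> [Cf [K [cK KU fK]]].
have n0 x : ~ K x -> {near x, cst 0 =1 f}.
  move=> nKx; have := compact_support_near0 cK fK nKx.
  by apply: filterS => y ->.
split.
- split; last by exists K.
  move=> x; have [Kx|nKx] := pselect (K x).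
    by apply: Ck1_continuous Cf _; exact: KU.
  rewrite /continuous_at (fK _ nKx).
  by apply: (cvg_trans (near_eq_cvg (n0 _ nKx))); exact: cvg_cst.
- move=> x v; have [Kx|nKx] := pselect (K x).
    by apply: Ck1_derivable Cf _; exact: KU.
  exact: near_eq_derivable (n0 _ nKx) (derivable_cst _ _ _).
- move=> v; have D0 y : ~ K y -> 'D_v f y = 0 by exact: derive_compact_support.
  split; last by exists K.
  move=> x; have [Kx|nKx] := pselect (K x); first exact/Cf.2/KU.
  rewrite /continuous_at (D0 _ nKx).
  apply: (@cvg_trans _ (cst 0 @ x)); last exact: cvg_cst.
  apply: near_eq_cvg; near=> y; rewrite D0//.
  by near: y; exact: near_notin_compact.
Unshelve. all: by end_near. Qed.

Lemma Cc_mull f g : continuous f -> Cc g -> Cc (fun x => f x * g x).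
Proof.
move=> cf [cg [K cK gK]]; split; last by exists K => // x /gK ->; rewrite mulr0.
by move=> x; apply: cvgM; [exact: cf|exact: cg].
Qed.

Lemma Cc_opp f : Cc f -> Cc (fun x => - f x).
Proof.
move=> [cf [K cK fK]]; split; first by move=> x; apply: cvgN; exact: cf.
by exists K => // x /fK ->; rewrite oppr0.
Qed.

Lemma Cc_add f g : Cc f -> Cc g -> Cc (fun x => f x + g x).
Proof.
move=> [cf [K cK fK]] [cg [L cL gL]]; split.
  by move=> x; apply: cvgD; [exact: cf|exact: cg].
exists (K `|` L); first exact: compactU.
by move=> x /not_orP[/fK -> /gL ->]; rewrite addr0.
Qed.

Lemma derive_mul (f g : V -> R) x v : derivable f x v -> derivable g x v ->
  'D_v (fun x => f x * g x) x = 'D_v f x * g x + f x * 'D_v g x.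
Proof.
move=> df dg; transitivity (f x * 'D_v g x + g x * 'D_v f x).
  exact: (deriveM df dg).
by rewrite addrC mulrC.
Qed.

Lemma Cc1_mul (f g : V -> R) : Cc1 f -> Cc1 g -> Cc1 (fun x => f x * g x).
Proof.
move=> [ccf df ccDf] [ccg dg ccDg]; split; first exact: Cc_mull ccf.1 ccg.
  by move=> x v; apply: derivableM.
move=> v; rewrite (_ : 'D_v _ = fun x => 'D_v f x * g x + f x * 'D_v g x).
  by apply: Cc_add; apply: Cc_mull => //; [exact: (ccDf v).1|exact: ccf.1].
by apply/funext => x; rewrite derive_mul.
Qed.

Lemma is_derive_line (f : V -> R) (e x : V) (t : R) :
  derivable f (t *: e + x) e ->
  is_derive t 1 (fun t => f (t *: e + x)) ('D_e f (t *: e + x)).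
Proof.
move=> df; have E : (fun h : R =>
      h^-1 *: (f ((h *: (1 : R) + t) *: e + x) - f (t *: e + x)))
    = (fun h : R => h^-1 *: (f (h *: e + (t *: e + x)) - f (t *: e + x))).
  by apply/funext => h; rewrite addrA -scalerDl [_ *: 1]mulr1.
by apply: DeriveDef; rewrite /derivable /derive/= E.
Qed.

End calculus.

(** * Borel sets, and the Lebesgue measure of balls *)

Section borel.
Context {R : realType}.

Lemma openX (T1 T2 : topologicalType) (A : set T1) (B : set T2) :
  open A -> open B -> open (A `*` B).
Proof.
move=> oA oB; rewrite openE => -[x y] [/= Ax By]; exists (A, B) => //=.
by split; exact: open_nbhs_nbhs.
Qed.

(** Second countability. The balls are indexed by those whose double is still
    contained in U: then a bump function supported in the closure of such a ball
    is compactly supported in U. *)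
Lemma open_ballsE (T : pseudoMetricType R) (I : Type) (q : I -> T) (U : set T) :
  (forall x e, 0 < e -> exists i, ball (q i) e x) -> open U ->
  U = \bigcup_(j in [set j : I * nat | ball (q j.1) (j.2.+1%:R^-1 *+ 2) `<=` U])
        ball (q j.1) (j.2.+1%:R^-1).
Proof.
move=> qdense oU; apply/seteqP; split=> [x Ux|x [[i k] /= + bx]]; last first.
  by apply; apply: le_ball bx; rewrite mulr2n lerDl invr_ge0.
have /nbhs_ballP[e /= e0 xeU] : nbhs x U by exact: open_nbhs_nbhs.
have e3 : 0 < e / 3 by rewrite divr_gt0.
near \oo => k.
have ke : k.+1%:R^-1 < e / 3.
  by near: k; exact: near_infty_natSinv_lt (PosNum e3).
have [i ix] := qdense x k.+1%:R^-1 ltac:(by rewrite invr_gt0).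
exists (i, k) => //= y iy; apply: xeU.
apply: (@le_ball _ _ _ (k.+1%:R^-1 + k.+1%:R^-1 *+ 2)).
  by rewrite mulr2n; move: ke; set h := _^-1; lra.
exact: ball_triangle (ball_sym ix) iy.
Unshelve. all: by end_near. Qed.

Definition ratr_mx n (v : 'rV[rat]_n) : 'rV[R]_n := map_mx ratr v.

Lemma ball_rVP n (x y : 'rV[R]_n) e : 0 < e ->
  ball x e y <-> forall i, `|x ord0 i - y ord0 i| < e.
Proof.
move=> e0; split=> [[_ xy] i|xy]; first exact: xy.
by split=> // i j; rewrite (ord1 i); exact: xy.
Qed.

Lemma ball_rV0 n (x : 'rV[R]_n) e : e <= 0 -> ball x e = set0.
Proof.
by move=> e0; apply/seteqP; split=> // y [/lt_le_trans/(_ e0)]; rewrite ltxx.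
Qed.

Lemma ratr_mx_dense n (x : 'rV[R]_n) e : 0 < e ->
  exists v, ball (ratr_mx v) e x.
Proof.
move=> e0.
have qP i : exists q : rat, `|ratr q - x ord0 i| < e.
  have [q] := @rat_in_itvoo R (x ord0 i - e) (x ord0 i + e) ltac:(lra).
  rewrite in_itv/= => /andP[? ?]; exists q.
  by rewrite ltr_distl; apply/andP; split; lra.
pose f i := xchoose (qP i).
exists (\row_i f i); apply/ball_rVP => // i.
by rewrite /ratr_mx !mxE; exact: (xchooseP (qP i)).
Qed.

Lemma measurable_ball_rV n (x : 'rV[R]_n) e : measurable (ball x e).
Proof.
have [e0|e0] := ltP 0 e; last by rewrite ball_rV0.
rewrite (_ : ball x e = \bigcap_(i in [set: 'I_n])
    ((fun y : 'rV[R]_n => y ord0 i) @^-1` (ball (x ord0 i) e))); last first.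
  apply/seteqP; split=> y.
    by move=> /ball_rVP xy i _; exact: xy.
  by move=> xy; apply/ball_rVP => // i; exact: xy.
apply: fin_bigcap_measurable; first exact: finite_finset.
move=> i _; rewrite -[X in measurable X]setTI.
apply: measurable_coord => //; apply: measurable_ball.
Qed.

Lemma open_measurable_rV n (U : set 'rV[R]_n) : open U -> measurable U.
Proof.
move=> /(open_ballsE (@ratr_mx_dense n)) ->; rewrite bigcup_mkcond.
apply: countable_bigcupT_measurable; first exact: countableP.
by move=> j; case: ifP => // _; exact: measurable_ball_rV.
Qed.

(** The product sigma-algebra contains all open sets because a ball of the
    product is a product of balls and countably many balls suffice. *)
Lemma open_measurable_rV2 m n (U : set ('rV[R]_m * 'rV[R]_n)) :
  open U -> measurable U.
Proof.
pose q (v : 'rV[rat]_m * 'rV[rat]_n) := (ratr_mx v.1, ratr_mx v.2).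
have qdense x e : 0 < e -> exists v, ball (q v) e x.
  move=> e0; have [v1 ?] := ratr_mx_dense x.1 e0.
  by have [v2 ?] := ratr_mx_dense x.2 e0; exists (v1, v2).
move=> /(open_ballsE qdense) ->; rewrite bigcup_mkcond.
apply: countable_bigcupT_measurable; first exact: countableP.
move=> j; case: ifP => // _.
exact: (measurableX (measurable_ball_rV _ _) (measurable_ball_rV _ _)).
Qed.

Lemma measurable_fun_preimage_open d (T : measurableType d) (f : T -> R) :
  (forall U, open U -> measurable (f @^-1` U)) -> measurable_fun setT f.
Proof.
move=> fo; apply: (measurability _ (RGenOInfty.measurableE R)).
move=> _ [_ [x ->] <-]; rewrite setTI; apply: fo; exact: interval_open.
Qed.

Lemma continuous_measurable_rV n (f : 'rV[R]_n -> R) :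
  continuous f -> measurable_fun setT f.
Proof.
move=> /continuousP cf; apply: measurable_fun_preimage_open => U oU.
by apply: open_measurable_rV; exact: cf.
Qed.

Lemma continuous_measurable_rV2 m n (f : 'rV[R]_m * 'rV[R]_n -> R) :
  continuous f -> measurable_fun setT f.
Proof.
move=> /continuousP cf; apply: measurable_fun_preimage_open => U oU.
by apply: open_measurable_rV2; exact: cf.
Qed.

Lemma preimage_row_cons_ball n (x : 'rV[R]_n.+1) e :
  @row_cons R n @^-1` ball x e =
  ball (row_uncons x).1 e `*` ball (row_uncons x).2 e.
Proof.
have [e0|e0] := ltP 0 e; last first.
  by rewrite !ball_rV0// preimage_set0 setX0.
apply/seteqP; split=> [[r v]/= /ball_rVP xy|[r v]/= [xr /ball_rVP xv]].
  split; first by have := xy e0 ord0; rewrite mxE unlift_none.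
  apply/ball_rVP => // i; rewrite mxE.
  by have := xy e0 (lift ord0 i); rewrite mxE liftK.
apply/ball_rVP => // i; rewrite mxE; case: unliftP => [j|] -> //=.
by have := xv e0 j; rewrite mxE.
Qed.

Lemma lebesgue_rV_ball n (x : 'rV[R]_n) e : 0 < e ->
  lebesgue_rV R n (ball x e) = ((e *+ 2) ^+ n)%:E.
Proof.
move=> e0; elim: n x => [|n IH] x /=.
  by rewrite diracE mem_set//; apply/ball_rVP => //; case.
rewrite /lebesgue_cons /pushforward preimage_row_cons_ball.
rewrite product_measure1E; last 2 first.
  apply: measurable_ball.
  exact: measurable_ball_rV.
rewrite IH exprS EFinM; congr (_ * _)%E.
exact: lebesgue_measure_ball (ltW e0).
Qed.

Lemma lebesgue_rV_ball_lty n (x : 'rV[R]_n) e :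
  (lebesgue_rV R n (ball x e) < +oo)%E.
Proof.
have [e0|e0] := ltP 0 e; last by rewrite ball_rV0 ?measure0.
by rewrite lebesgue_rV_ball// ltry.
Qed.

Lemma lebesgue_rV_ball_gt0 n (x : 'rV[R]_n) e : 0 < e ->
  (0 < lebesgue_rV R n (ball x e))%E.
Proof.
by move=> e0; rewrite lebesgue_rV_ball// lte_fin exprn_gt0// pmulrn_lgt0.
Qed.

End borel.

(** * Integrals of compactly supported continuous functions *)

Section integration.
Context {R : realType}.

Lemma integrable_bounded_support d (T : measurableType d)
    (mu : {measure set T -> \bar R}) (f : T -> R) (B : set T) (M : R) :
  measurable B -> (mu B < +oo)%E -> measurable_fun setT f ->
  (forall x, `|f x| <= M) -> (forall x, ~ B x -> f x = 0) ->
  mu.-integrable setT (EFin \o f).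
Proof.
move=> mB Boo mf fM fB.
rewrite (_ : EFin \o f = (EFin \o f) \_ B); last first.
  apply/funext => x; rewrite patchE; case: ifPn => // /negP; rewrite inE => nBx.
  by rewrite /= fB.
apply: (integrable_mkcond _ mB).1; apply: measurable_bounded_integrable => //.
  exact: measurable_funTS.
exists M; split; first exact: num_real.
by move=> N MN x _; exact: le_trans (fM x) (ltW MN).
Qed.

Lemma compact_sub_ball (V : normedModType R) (K : set V) : compact K ->
  exists2 M, 0 < M & K `<=` ball 0 M.
Proof.
move=> /compact_bounded[M [_ KM]]; exists (`|M| + 2); first by rewrite ltr_wpDl.
move=> x /(KM (`|M| + 1)) => /(_ (ltr_pwDr ltr01 (ler_norm M))) xM.
by rewrite -ball_normE /ball_/= sub0r normrN (le_lt_trans xM)// ltrD2l ltr1n.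
Qed.

Lemma Cc_bounded (V : normedModType R) (f : V -> R) : Cc f ->
  exists M, forall x, `|f x| <= M.
Proof.
move=> [cf [K cK fK]].
have /compact_bounded[M [_ fM]] : compact (f @` K).
  by apply: continuous_compact => //; exact: continuous_subspaceT.
exists (`|M| + 1) => x; have [Kx|/fK ->] := pselect (K x).
  by apply: fM; [rewrite ltr_pwDr// ler_norm|exists x].
by rewrite normr0 addr_ge0.
Qed.

Lemma Cc_ball_support (V : normedModType R) (f : V -> R) : Cc f ->
  exists2 M, 0 < M & forall x, ~ ball 0 M x -> f x = 0.
Proof.
move=> [_ [K /compact_sub_ball[M M0 KM] fK]]; exists M => // x nMx.
by apply: fK => /KM.
Qed.

Lemma integrable_Cc n (f : 'rV[R]_n -> R) : Cc f ->
  (lebesgue_rV R n).-integrable setT (EFin \o f).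
Proof.
move=> ccf; have [M fM] := Cc_bounded ccf.
have [e e0 fe] := Cc_ball_support ccf.
apply: integrable_bounded_support fM fe.
- exact: measurable_ball_rV.
- exact: lebesgue_rV_ball_lty.
- exact: continuous_measurable_rV ccf.1.
Qed.

Lemma integrable_Cc2 m n (f : 'rV[R]_m * 'rV[R]_n -> R) : Cc f ->
  (lebesgue_rV R m \x lebesgue_rV R n)%E.-integrable setT (EFin \o f).
Proof.
move=> ccf; have [M fM] := Cc_bounded ccf.
have [e e0 fe] := Cc_ball_support ccf.
apply: (@integrable_bounded_support _ _ (lebesgue_rV R m \x lebesgue_rV R n)%E
  f (ball 0 e `*` ball 0 e) M).
- by apply: measurableX; exact: measurable_ball_rV.
- have ball_lty k := @lebesgue_rV_ball_lty R k 0 e.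
  have ball_fin k : lebesgue_rV R k (ball 0 e) \is a fin_num.
    by rewrite ge0_fin_numE.
  have := lte_mul_pinfty (measure_ge0 _ _) (ball_fin m) (ball_lty n).
  by rewrite -product_measure1E//; exact: measurable_ball_rV.
- exact: continuous_measurable_rV2 ccf.1.
- exact: fM.
- by move=> x nx; apply: fe.
Qed.

Lemma integral_derive_R (g dg : R -> R) (M : R) : 0 < M ->
  (forall r : R, is_derive r 1 g (dg r)) -> continuous dg ->
  (forall r, M <= `|r| -> g r = 0) -> (forall r, M <= `|r| -> dg r = 0) ->
  (\int[lebesgue_measure]_r (dg r)%:E = 0)%E.
Proof.
move=> M0 Dg cdg gM dgM.
have cg : continuous g.
  by move=> r; apply: differentiable_continuous; apply/derivable1_diffP.
transitivity (\int[lebesgue_measure]_(r in `[(- M)%R, M]) (dg r)%:E)%E.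
  rewrite [RHS]integral_mkcond; apply: eq_integral => r _.
  rewrite patchE; case: ifPn => // /negP; rewrite inE/= in_itv/= => rM.
  rewrite dgM// leNgt; apply/negP => /ltW; rewrite ler_norml; exact: rM.
rewrite (@continuous_FTC2 _ dg g)//.
- by rewrite !gM ?normrN ?ler_norm// subee.
- lra.
- exact: continuous_subspaceT.
- by split=> [r _||]; [|apply: cvg_at_right_filter; exact: cg
    |apply: cvg_at_left_filter; exact: cg].
- by move=> r _; rewrite derive1E; have [_ ->] := Dg r.
Qed.

Lemma row_cons_affine n (r : R) (v : 'rV[R]_n) :
  row_cons (r, v) = r *: delta_mx ord0 ord0 + row_cons (0, v).
Proof.
apply/rowP => i; rewrite !mxE/=; case: unliftP => [j|] -> /=.
  by rewrite mulr0 add0r.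
by rewrite mulr1 addr0.
Qed.

(** The first coordinate is the one that the Lebesgue measure splits off, so by
    Fubini the integral is computed along the lines directed by e, where the
    fundamental theorem of calculus gives 0. *)
Lemma integral_derive_rV n (f : 'rV[R]_n.+1 -> R) : Cc1 f ->
  (\int[lebesgue_rV R n.+1]_x
     ('D_(delta_mx ord0 ord0 : 'rV[R]_n.+1) f x)%:E = 0)%E.
Proof.
move=> [ccf df ccDf]; set e := delta_mx _ _ : 'rV[R]_n.+1.
have mD : measurable_fun setT ('D_e f).
  exact: continuous_measurable_rV (ccDf e).1.
pose h (z : R * 'rV[R]_n) := 'D_e f (row_cons z).
have mh : measurable_fun setT h.
  exact: (measurableT_comp mD (@measurable_row_cons R n)).
have [M hM] := Cc_bounded (ccDf e).
have [e1 e10 De1] := Cc_ball_support (ccDf e).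
have [e2 e20 fe2] := Cc_ball_support ccf.
pose mu := (@lebesgue_measure R \x lebesgue_rV R n)%E.
have ih : mu.-integrable setT (EFin \o h).
  apply: (@integrable_bounded_support _ _ mu h
    (@row_cons R n @^-1` ball 0 e1) M) => //.
  - rewrite -[X in measurable X]setTI; apply: measurable_row_cons => //.
    exact: measurable_ball_rV.
  - exact: (@lebesgue_rV_ball_lty R n.+1).
  - by move=> z; exact: hM.
  - by move=> z nz; apply: De1.
transitivity (\int[mu]_z (h z)%:E)%E.
  rewrite [LHS]integral_pushforward//; first exact: measurable_row_cons.
  exact/measurable_EFinP.
rewrite -(integral21_prod_meas1 ih) /fubini_G/=.
apply: integral0_eq => v _; set w := row_cons (0, v).
have lineE r : row_cons (r, v) = r *: e + w by exact: row_cons_affine.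
have large r : Num.max e1 e2 <= `|r| ->
    ~ ball 0 e1 (r *: e + w) /\ ~ ball 0 e2 (r *: e + w).
  rewrite ge_max -lineE => /andP[r1 r2].
  split=> /ball_rVP => /(_ ltac:(done) ord0);
    by rewrite !mxE unlift_none/= sub0r normrN ltNge ?r1 ?r2.
under eq_integral do rewrite /h lineE.
apply: (@integral_derive_R (fun r => f (r *: e + w))
  (fun r => 'D_e f (r *: e + w)) (Num.max e1 e2)).
- by rewrite lt_max e10.
- by move=> r; apply: is_derive_line.
- move=> r; apply: (@continuous_comp R 'rV[R]_n.+1 R
    (fun r => r *: e + w) ('D_e f)).
    by apply: cvgD; [exact: scalel_continuous|exact: cvg_cst].
  exact: (ccDf e).1.
- by move=> r /large[_ /fe2].
- by move=> r /large[/De1].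
Qed.

End integration.

(** * Bump functions *)

Section bumps.
Context {R : realType}.

(** The simplest C^1 function that is positive exactly on a half-line. *)
Definition sqpos (s : R) : R := Num.max 0 s ^+ 2.

Lemma is_derive_sqpos (s : R) : is_derive s 1 sqpos (2 * Num.max 0 s).
Proof.
(* the derivative is 2-Lipschitz, hence a quadratic remainder *)
have bnd (h : R) :
    `|h * (2 * Num.max 0 s) - (sqpos (h + s) - sqpos s)| <= h ^+ 2.
  rewrite /sqpos; case: (lerP 0 s) => s0; case: (lerP 0 (h + s)) => hs0;
    rewrite ler_norml; apply/andP; split; nra.
have cvgq : (fun h => h^-1 *: (sqpos (h *: (1 : R) + s) - sqpos s)) @ 0^'
    --> 2 * Num.max 0 s.
  apply/cvgrPdist_le => e e0; near=> h.
  have h0 : h != 0 by near: h; exact: nbhs_dnbhs_neq.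
  rewrite -(ler_pM2l (_ : 0 < `|h|)) ?normr_gt0// -normrM.
  rewrite mulrBr [h *: 1]mulr1 -[_ *: _]/(_ * _) mulVKf//.
  apply: le_trans (bnd h) _; rewrite -real_normK ?num_real// expr2 ler_wpM2l//.
  by near: h; exact: dnbhs0_le.
by apply: DeriveDef; [apply/cvg_ex; exists (2 * Num.max 0 s)|exact: cvg_lim].
Unshelve. all: by end_near. Qed.

Lemma continuous_dsqpos : continuous (fun s : R => 2 * Num.max 0 s).
Proof.
move=> s; apply: cvgM; first exact: cvg_cst.
by apply: (@continuous_max _ _ (cst 0) id); [exact: cst_continuous|].
Qed.

Lemma sqpos_ge0 s : 0 <= sqpos s. Proof. exact: sqr_ge0. Qed.

Lemma sqpos_le0 s : s <= 0 -> sqpos s = 0.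
Proof. by move=> s0; rewrite /sqpos max_l// expr0n. Qed.

Lemma sqpos_gt0 s : 0 < s -> 0 < sqpos s.
Proof. by move=> s0; rewrite /sqpos max_r ?exprn_gt0// ltW. Qed.

(** A C^1 substitute for the truncation min (s, 1) of nonnegative numbers. *)
Definition clip (s : R) : R := 1 - sqpos (1 - s).

Lemma clip0 : clip 0 = 0.
Proof. by rewrite /clip /sqpos subr0 max_r// expr1n subrr. Qed.

Lemma clip_ge1 s : 1 <= s -> clip s = 1.
Proof. by move=> s1; rewrite /clip sqpos_le0 ?subr0// subr_le0. Qed.

Lemma clip_le s t : s <= t -> clip s <= clip t.
Proof.
move=> st; rewrite /clip lerD2l lerN2 /sqpos.
have max0 (u : R) : 0 <= Num.max 0 u by rewrite le_max lexx.
rewrite lerXn2r ?nnegrE// ge_max max0 /=.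
by rewrite le_max lerD2l lerN2 st orbT.
Qed.

Lemma clip_ge0 s : 0 <= s -> 0 <= clip s.
Proof. by move=> s0; rewrite -clip0 clip_le. Qed.

Lemma clip_le1 s : clip s <= 1.
Proof. by rewrite /clip lerBlDr lerDl sqpos_ge0. Qed.

Lemma clip_gt0 s : 0 < s -> 0 < clip s.
Proof.
move=> s0; rewrite /clip /sqpos subr_gt0.
case: (lerP 0 (1 - s)) => ?; last by rewrite expr0n.
by rewrite expr_lt1//; lra.
Qed.

Lemma Ck1_clip (V : normedModType R) (f : V -> R) :
  Ck 1 setT f -> Ck 1 setT (fun x => clip (f x)).
Proof.
move=> Cf; apply: Ck1_add; [exact: openT|exact: Ck_cst|].
under eq_fun do rewrite -mulN1r.
apply: Ck1_mul; [exact: openT|exact: Ck_cst|].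
apply: (Ck1_comp (phi := sqpos) is_derive_sqpos continuous_dsqpos).
apply: Ck1_add; [exact: openT|exact: Ck_cst|].
under eq_fun do rewrite -mulN1r.
by apply: Ck1_mul; [exact: openT|exact: Ck_cst|].
Qed.

Lemma Ck1_coord n (i : 'I_n) : Ck 1 setT (fun x : 'rV[R]_n => x ord0 i).
Proof.
apply: (@Ck1_comp_affine _ _ _ _ (fun v : 'rV[R]_n => v ord0 i) id).
- by move=> x; exact: differentiable_coord.
- by move=> h v x; rewrite !mxE.
- split=> [x _|v x _]; first exact/derivable1_diffP/derivable_id.
  rewrite (_ : 'D_v id = cst v); first exact: cst_continuous.
  by apply/funext => y; rewrite derive_id.
Qed.

(** A product over the coordinates, so that it is positive exactly on a ball of
    the sup norm, which is the norm of row vectors. *)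
Definition box_bump n (q : 'rV[R]_n) (r : R) (x : 'rV[R]_n) : R :=
  \prod_i sqpos (r ^+ 2 - (x ord0 i - q ord0 i) ^+ 2).

Lemma Ck1_box_bump n (q : 'rV[R]_n) r : Ck 1 setT (box_bump q r).
Proof.
apply: Ck1_prod => [|i]; first exact: openT.
apply: (Ck1_comp (phi := sqpos) is_derive_sqpos continuous_dsqpos).
apply: Ck1_add; [exact: openT|exact: Ck_cst|].
under eq_fun do rewrite -mulN1r.
apply: Ck1_mul; [exact: openT|exact: Ck_cst|].
by apply: Ck1_mul; [exact: openT|..]; (apply: Ck1_add;
  [exact: openT|exact: Ck1_coord|exact: Ck_cst]).
Qed.

Lemma box_bump_ge0 n (q : 'rV[R]_n) r x : 0 <= box_bump q r x.
Proof. by apply: prodr_ge0 => i _; exact: sqpos_ge0. Qed.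

Lemma box_bump_gt0 n (q : 'rV[R]_n) r x : 0 < r -> ball q r x ->
  0 < box_bump q r x.
Proof.
move=> r0 /(ball_rVP _ _ r0) qx; apply: prodr_gt0 => i _; apply: sqpos_gt0.
rewrite subr_gt0 -real_normK ?num_real// distrC.
by rewrite ltrXn2r// qx.
Qed.

Lemma box_bump_supported n (q : 'rV[R]_n) r (U : set 'rV[R]_n) : 0 < r ->
  ball q (r *+ 2) `<=` U -> compactly_supported U (box_bump q r).
Proof.
move=> r0 qU; pose I i := `[q ord0 i - r, q ord0 i + r]%classic.
exists [set v : 'rV[R]_n | forall i, I i (v ord0 i)].
have r2 : 0 < r *+ 2 by rewrite pmulrn_lgt0.
split.
- apply: (@rV_compact _ _ I) => i; exact: segment_compact.
- move=> v vK; apply: qU; apply/ball_rVP => // i.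
  have := vK i; rewrite /I /= in_itv/= => /andP[v1 v2].
  by rewrite ltr_distl; apply/andP; split; lra.
- move=> x /existsNP[i]; rewrite /I /= in_itv/= => /negP.
  rewrite -ler_distl -ltNge => xi.
  rewrite /box_bump (bigD1 i)//= sqpos_le0 ?mul0r//.
  by rewrite subr_le0 -[leRHS]real_normK ?num_real// lerXn2r// ?nnegrE ltW.
Qed.

Lemma compactly_supported_sum (V : normedModType R) (U : set V)
    (F : nat -> V -> R) k :
  (forall i, compactly_supported U (F i)) ->
  compactly_supported U (fun x => \sum_(i < k) F i x).
Proof.
move=> FU; elim: k => [|k [K [cK KU FK]]].
  exists set0; split=> [||x _]; [exact: compact0|exact: sub0set|].
  by rewrite big_ord0.
have [L [cL LU FL]] := FU k.
exists (K `|` L); split; [exact: compactU|by rewrite subUset|].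
by move=> x /not_orP[/FK xK /FL xL]; rewrite big_ord_recr/= xK xL addr0.
Qed.

Lemma compactly_supported_comp (V : normedModType R) (U : set V) (f : V -> R)
    (phi : R -> R) :
  phi 0 = 0 -> compactly_supported U f -> compactly_supported U (phi \o f).
Proof.
by move=> phi0 [K [cK KU fK]]; exists K; split=> // x /fK /= ->.
Qed.

Lemma integral_Cc_gt0 n (f : 'rV[R]_n -> R) x0 : Cc f -> (forall x, 0 <= f x) ->
  0 < f x0 -> (0 < \int[lebesgue_rV R n]_x (f x)%:E)%E.
Proof.
move=> ccf f0 fx0.
have f20 : 0 < f x0 / 2 by rewrite divr_gt0.
have [e /= e0 fe] : nbhs_ball x0 [set x | f x0 / 2 < f x].
  apply/nbhs_ballP; have := cvgr_gt _ (ccf.1 x0); apply.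
  by rewrite ltr_pdivrMr// ltr_pMr// ltr1n.
apply: (@lt_le_trans _ _
  (\int[lebesgue_rV R n]_(x in ball x0 e) (cst (f x0 / 2)%:E x))%E).
  rewrite integral_cst; last exact: measurable_ball_rV.
  by apply: mule_gt0; [rewrite lte_fin|exact: lebesgue_rV_ball_gt0].
have mf : measurable_fun setT (EFin \o f).
  by apply/measurable_EFinP; exact: continuous_measurable_rV ccf.1.
apply: (@le_trans _ _ (\int[lebesgue_rV R n]_(x in ball x0 e) (f x)%:E)%E).
  apply: ge0_le_integral.
  - exact: measurable_ball_rV.
  - by move=> x _; rewrite lee_fin ltW.
  - exact: measurable_cst.
  - exact: measurable_funTS.
  - by move=> x /fe /= /ltW; rewrite lee_fin.
apply: ge0_subset_integral => //.
- exact: measurable_ball_rV.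
- by move=> x _; rewrite lee_fin.
Qed.

Lemma exists_bump n (U : set 'rV[R]_n) x0 : open U -> U x0 ->
  exists a : 'rV[R]_n -> R, [/\ Ck 1 setT a, compactly_supported U a,
    forall x, 0 <= a x <= 1 & (0 < \int[lebesgue_rV R n]_x (a x)%:E)%E].
Proof.
move=> oU Ux0.
have /nbhs_ballP[e /= e0 eU] : nbhs x0 U by exact: open_nbhs_nbhs.
have e20 : 0 < e / 2 by rewrite divr_gt0.
pose a := clip \o box_bump x0 (e / 2).
have Ca : Ck 1 setT a by apply: Ck1_clip; exact: Ck1_box_bump.
have sa : compactly_supported U a.
  apply: compactly_supported_comp; first exact: clip0.
  by apply: box_bump_supported => //; rewrite -[_ / 2 *+ 2]mulr_natr divfK.
have a0 x : 0 <= a x by apply: clip_ge0; exact: box_bump_ge0.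
exists a; split=> //; first by move=> x; rewrite a0 clip_le1.
apply: (@integral_Cc_gt0 _ _ x0) => //.
  by have [] : Cc1 a by apply: (@C1c_Cc1 _ _ U); split=> //; exact: Ck_sub Ca.
by apply: clip_gt0; apply: box_bump_gt0 => //; exact: ballxx.
Qed.

(** The open set U is a countable union of balls carrying bumps B j. The clipped
    sums clip (k * \sum_(j < k) B j) are increasing in k; at a point of U some
    B j is positive, so the factor k eventually brings the argument of clip
    above 1. They therefore increase to the indicator of U, and by monotone
    convergence their integrals tend to the measure of U. *)
Lemma exists_large_bump n (U : set 'rV[R]_n) (M : R) : open U ->
  lebesgue_rV R n U = +oo%E ->
  exists b : 'rV[R]_n -> R, [/\ Ck 1 setT b, compactly_supported U b,
    forall x, 0 <= b x <= 1 & (M%:E < \int[lebesgue_rV R n]_x (b x)%:E)%E].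
Proof.
move=> oU Uoo.
pose h k : R := k.+1%:R^-1.
have h0 k : 0 < h k by rewrite invr_gt0.
pose good (v : 'rV[rat]_n) k := ball (ratr_mx v : 'rV[R]_n) (h k *+ 2) `<=` U.
pose B (j : nat) : 'rV[R]_n -> R :=
  if (unpickle j : option ('rV[rat]_n * nat)) is Some (v, k) then
    if `[< good v k >] then box_bump (ratr_mx v) (h k) else cst 0
  else cst 0.
have supp0 : compactly_supported U (cst (0 : R)).
  by exists set0; split=> //; exact: compact0.
have B0 j x : 0 <= B j x.
  rewrite /B; case: unpickle => [[v k]|//]; case: ifP => // _.
  exact: box_bump_ge0.
have CB j : Ck 1 setT (B j).
  rewrite /B; case: unpickle => [[v k]|]; last exact: Ck_cst.
  by case: ifP => _; [exact: Ck1_box_bump|exact: Ck_cst].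
have sB j : compactly_supported U (B j).
  rewrite /B; case: unpickle => [[v k]|//]; case: ifP => // /asboolP gvk.
  exact: box_bump_supported.
have BU x : U x -> exists j, 0 < B j x.
  move=> Ux; have := open_ballsE (@ratr_mx_dense R n) oU.
  move=> /seteqP[/(_ _ Ux)[[v k] /= gvk vx] _]; exists (pickle (v, k)).
  rewrite /B pickleK ifT; last exact/asboolP.
  exact: box_bump_gt0.
pose S (k : nat) (x : 'rV[R]_n) := k%:R * \sum_(j < k) B j x.
pose b k x := clip (S k x).
have S0 k x : 0 <= S k x by rewrite mulr_ge0// sumr_ge0.
have Snd x : nondecreasing_seq (S ^~ x).
  apply/nondecreasing_seqP => k; rewrite /S big_ord_recr/=.
  apply: ler_pM => //; first by rewrite sumr_ge0.
    by rewrite ler_nat.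
  by rewrite lerDl.
have Cb k : Ck 1 setT (b k).
  apply: Ck1_clip; apply: Ck1_mul; [exact: openT|exact: Ck_cst|].
  by apply: Ck1_sum => //; exact: openT.
have sb k : compactly_supported U (b k).
  apply: (@compactly_supported_comp _ _ (fun x => \sum_(j < k) B j x)
    (fun s => clip (k%:R * s))); first by rewrite mulr0 clip0.
  exact: compactly_supported_sum.
have b01 k x : 0 <= b k x <= 1 by rewrite clip_ge0 ?clip_le1.
apply: contrapT => nb.
have bM k : (\int[lebesgue_rV R n]_x (b k x)%:E <= M%:E)%E.
  by rewrite leNgt; apply/negP => Mb; apply: nb; exists (b k).
have mb k : measurable_fun setT (EFin \o b k).
  apply/measurable_EFinP; apply: continuous_measurable_rV => x.
  exact: (Ck1_continuous (Cb k)).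
have bnd x : nondecreasing_seq (fun k => (b k x)%:E).
  by move=> k l kl; rewrite lee_fin clip_le// Snd.
have lim_b x : U x -> limn (fun k => (b k x)%:E) = 1%E.
  move=> Ux; apply/cvg_lim => //; apply: cvg_near_cst.
  have [j Bj] := BU x Ux; near=> k; congr (_%:E); apply: clip_ge1.
  have jk : (j < k)%N by near: k; exact: nbhs_infty_gt.
  have kB : (B j x)^-1 <= k%:R by near: k; exact: nbhs_infty_ger.
  rewrite -(mulVf (lt0r_neq0 Bj)).
  apply: ler_pM => //; first by rewrite invr_ge0.
  by rewrite (bigD1 (Ordinal jk))//= lerDl sumr_ge0.
have := @cvg_monotone_convergence _ _ _ (lebesgue_rV R n) setT measurableT
  (fun k x => (b k x)%:E) mb.
have b0 k x : setT x -> (0 <= (b k x)%:E)%E.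
  by move=> _; rewrite lee_fin; case/andP: (b01 k x).
move=> /(_ b0 (fun x _ => bnd x)) lim_int.
have mU := open_measurable_rV oU.
have : (\int[lebesgue_rV R n]_(x in U) (cst 1 x) <= M%:E)%E.
  apply: (@le_trans _ _ (\int[lebesgue_rV R n]_x limn (fun k => (b k x)%:E))%E).
    rewrite integral_mkcond; apply: ge0_le_integral => //.
    - by move=> x _; rewrite patchE; case: ifP.
    - exact/(measurable_restrictT _ _).1.
    - apply: (emeasurable_fun_cvg (fun k x => (b k x)%:E)) => // x _.
      by apply: ereal_nondecreasing_is_cvgn; exact: bnd.
    - move=> x _; rewrite patchE; case: ifPn => [/set_mem Ux|_].
        by rewrite lim_b.
      apply: lime_ge; first by apply: ereal_nondecreasing_is_cvgn; exact: bnd.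
      by apply: nearW => k; exact: b0.
  rewrite -(cvg_lim _ lim_int)//.
  apply: lime_le; first by apply/cvg_ex; eexists; exact: lim_int.
  exact: nearW.
rewrite integral_cst// mul1e => /le_lt_trans/(_ (ltry M)).
by have := Uoo => /= ->; rewrite ltxx.
Unshelve. all: by end_near. Qed.

End bumps.

(** * Slices and integration by parts *)

Section slices.
Context {R : realType} {V W : normedModType R}.

Lemma continuous_pairr (x : V) : continuous (fun y : W => (x, y)).
Proof. by move=> y; apply: cvg_pair; [exact: cvg_cst|exact: cvg_id]. Qed.

Lemma continuous_pairl (y : W) : continuous (fun x : V => (x, y)).
Proof. by move=> x; apply: cvg_pair; [exact: cvg_id|exact: cvg_cst]. Qed.

Lemma Cc_slicer (F : V * W -> R) x : Cc F -> Cc (fun y => F (x, y)).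
Proof.
move=> [cF [K cK FK]]; split.
  move=> y; apply: continuous_comp; [exact: continuous_pairr|exact: cF].
exists (snd @` K).
  apply: continuous_compact => //; apply: continuous_subspaceT => z.
  exact: cvg_snd.
by move=> y nKy; apply: FK => Kxy; apply: nKy; exists (x, y).
Qed.

Lemma Cc_slicel (F : V * W -> R) y : Cc F -> Cc (fun x => F (x, y)).
Proof.
move=> [cF [K cK FK]]; split.
  move=> x; apply: continuous_comp; [exact: continuous_pairl|exact: cF].
exists (fst @` K).
  apply: continuous_compact => //; apply: continuous_subspaceT => z.
  exact: cvg_fst.
by move=> x nKx; apply: FK => Kxy; apply: nKx; exists (x, y).
Qed.

(** Derivatives of a slice are derivatives in the directions (v, 0). *)
Lemma growth_slicel (F : V * W -> R) (x v : V) (y : W) (h : R) :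
  F (h *: v + x, y) = F (h *: (v, 0) + (x, y)).
Proof. by congr F; congr pair; rewrite /= scaler0 add0r. Qed.

Lemma derive_slicel (F : V * W -> R) (x v : V) (y : W) :
  'D_v (fun x => F (x, y)) x = 'D_(v, 0) F (x, y).
Proof. by rewrite /derive/=; under eq_fun do rewrite growth_slicel. Qed.

Lemma Cc1_slicel (F : V * W -> R) y : Cc1 F -> Cc1 (fun x => F (x, y)).
Proof.
move=> [ccF dF ccDF]; split; first exact: Cc_slicel.
  move=> x v; rewrite /derivable/=; under eq_fun do rewrite growth_slicel.
  exact: (dF (x, y) (v, 0)).
move=> v; rewrite (_ : 'D_v _ = fun x => 'D_(v, 0) F (x, y)).
  exact: (Cc_slicel y (ccDF (v, 0))).
by apply/funext => x; rewrite derive_slicel.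
Qed.

End slices.

Section parts.
Context {R : realType} {n : nat}.
Local Notation V := 'rV[R]_n.+1.
Local Notation leb := (lebesgue_rV R n.+1).
Local Notation e0 := (delta_mx ord0 ord0 : V).

(** On the line through a point x with u x != 0, directed by e0, the function u
    vanishes on both sides at distance T: apply the mean value theorem on the
    side where u increases, from x if u x < 0 and towards x if u x > 0. *)
Lemma exists_derive_gt0 (u : V -> R) : Cc1 u -> u != cst 0 ->
  exists x, 0 < 'D_e0 u x.
Proof.
move=> [ccu du ccDu] /eqP u0.
have [x ux0] : exists x, u x <> 0.
  by apply/existsNP => ux; apply: u0; apply/funext.
have [M M0 uM] := Cc_ball_support ccu.
pose g (t : R) := u (t *: e0 + x).
have dg (t : R) : is_derive t 1 g ('D_e0 u (t *: e0 + x)).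
  exact: is_derive_line.
have cg : continuous g.
  by move=> t; apply: differentiable_continuous; apply/derivable1_diffP.
have g0 : g 0 = u x by rewrite /g scale0r add0r.
pose T := M + `|x ord0 ord0|.
have T0 : 0 < T by rewrite ltr_wpDr.
have gT t : `|t| = T -> g t = 0.
  move=> tT; apply: uM => /(ball_rVP _ _ M0)/(_ ord0).
  rewrite !mxE/= mulr1 sub0r normrN; apply/negP; rewrite -leNgt.
  have := ler_normB (t + x ord0 ord0) (x ord0 ord0).
  by rewrite addrK tT /T; lra.
have [ux|ux|/esym//] := ltrgtP (u x) 0.
  have [//|c _] := @MVT _ g _ 0 T T0 (fun x _ => dg x) _.
    exact: continuous_subspaceT.
  rewrite gT ?gtr0_norm// g0 sub0r subr0 => E; exists (c *: e0 + x).
  by rewrite -(pmulr_lgt0 _ T0) -E oppr_gt0.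
have NT0 : - T < 0 by rewrite oppr_lt0.
have [//|c _] := @MVT _ g _ (- T) 0 NT0 (fun x _ => dg x) _.
  exact: continuous_subspaceT.
rewrite (gT (- T)) ?normrN ?gtr0_norm// g0 subr0 sub0r opprK => E.
exists (c *: e0 + x).
by rewrite -(pmulr_lgt0 _ T0) -E.
Qed.

(** Integration by parts in the first variable, the second one being a
    parameter: for each y, the x-derivative of u x * H (x, y) has integral 0. *)
Lemma integral2_by_parts (u : V -> R) (H : V * V -> R) : Cc1 u -> Cc1 H ->
  (\int[leb \x leb]_z (u z.1 * - 'D_(e0, 0) H z)%:E =
   \int[leb \x leb]_z ('D_e0 u z.1 * H z)%:E)%E.
Proof.
move=> C1u C1H; have [[cu _] du ccDu] := C1u; have [ccH dH ccDH] := C1H.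
have cfst (f : V -> R) : continuous f -> continuous (fun z : V * V => f z.1).
  by move=> cf z; apply: continuous_comp; [exact: cvg_fst|exact: cf].
pose F1 (z : V * V) := 'D_e0 u z.1 * H z.
pose F2 (z : V * V) := u z.1 * 'D_(e0, 0) H z.
have ccF1 : Cc F1 by apply: Cc_mull => //; exact: (cfst _ (ccDu e0).1).
have ccF2 : Cc F2 by apply: Cc_mull => //; exact: (cfst u cu).
have iF1 := integrable_Cc2 ccF1; have iF2 := integrable_Cc2 ccF2.
have iF := integrable_Cc2 (Cc_add ccF1 ccF2).
have I0 : (\int[leb \x leb]_z (F1 z + F2 z)%:E = 0)%E.
  rewrite -(integral21_prod_meas1 iF) /fubini_G/=; apply: integral0_eq => y _.
  have C1Hy := Cc1_slicel y C1H.
  rewrite -[RHS](integral_derive_rV (Cc1_mul C1u C1Hy)).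
  apply: eq_integral => x _; congr (_%:E).
  rewrite derive_mul; [|exact: du|by have [_ dHy _] := C1Hy; exact: dHy].
  by rewrite derive_slicel.
have : (\int[leb \x leb]_z ((F1 z)%:E + (F2 z)%:E) = 0)%E by rewrite -[RHS]I0.
rewrite integralD// => I12.
transitivity (- \int[leb \x leb]_z (F2 z)%:E)%E.
  under eq_integral do rewrite mulrN EFinN.
  rewrite integralN//; exact: integrable_add_def.
move: I12; rewrite -/(F1 _) -(fineK (integrable_fin_num _ iF1))//.
rewrite -(fineK (integrable_fin_num _ iF2))// -EFinD => -[I12].
by rewrite -EFinN; congr (_%:E); lra.
Qed.

End parts.

(** * The nonlocal divergence of a tensor product *)

Section tensor.
Context {R : realType} {V W : normedModType R}.

Definition tensor (a : V -> R) (b : W -> R) (z : V * W) : R := a z.1 * b z.2.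

Lemma Ck1_tensor (a : V -> R) (b : W -> R) : Ck 1 setT a -> Ck 1 setT b ->
  Ck 1 setT (tensor a b).
Proof.
move=> Ca Cb; apply: Ck1_mul; first exact: openT.
- apply: (@Ck1_comp_affine _ _ _ (fst : V * W -> V) fst) => //.
  by move=> z; apply: linear_differentiable => {}z; exact: cvg_fst.
- apply: (@Ck1_comp_affine _ _ _ (snd : V * W -> W) snd) => //.
  by move=> z; apply: linear_differentiable => {}z; exact: cvg_snd.
Qed.

Lemma compactly_supported_tensor (A : set V) (B : set W) a b :
  compactly_supported A a -> compactly_supported B b ->
  compactly_supported (A `*` B) (tensor a b).
Proof.
move=> [K [cK KA aK]] [L [cL LB bL]]; exists (K `*` L); split.
- exact: compact_setX.
- by move=> z [/KA ? /LB].
- by move=> z /not_andP[/aK|/bL] z0; rewrite /tensor z0 ?mul0r ?mulr0.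
Qed.

End tensor.

Section nonlocal_estimate.
Context {R : realType} {n : nat}.
Local Notation V := 'rV[R]_n.+1.
Local Notation leb := (lebesgue_rV R n.+1).
Local Notation e0 := (delta_mx ord0 ord0 : V).

Lemma integral_tensor (a b : V -> R) : Cc a -> Cc b -> Cc (tensor a b) ->
  (\int[leb \x leb]_z (tensor a b z)%:E =
   \int[leb]_x (a x)%:E * \int[leb]_y (b y)%:E)%E.
Proof.
move=> cca ccb cct; have ib := integrable_Cc ccb; have ia := integrable_Cc cca.
rewrite -(integral12_prod_meas1 (integrable_Cc2 cct)) /fubini_F/=.
under eq_integral => x _.
  rewrite /tensor/=; under eq_integral do rewrite EFinM.
  rewrite integralZl//; over.
by rewrite -(fineK (integrable_fin_num _ ib))// integralZr.
Qed.

Variables (Omega : set V) (omega : V * V -> R).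
Hypotheses (oOmega : open Omega) (Comega : Ck 1 (Omega `*` Omega) omega).

(** Only the points x of K contribute to the integral. Near such a point b
    vanishes, so that the integrand in the definition of nl_adjoint reduces to
    minus the derivative of H := omega * tensor a b in the direction (e0, 0).
    Fubini and an integration by parts then move the derivative to u. *)
Lemma integral_nl_adjoint (u a b : V -> R) (K : set V) :
  Cc1 u -> compact K -> K `<=` Omega -> (forall x, ~ K x -> u x = 0) ->
  Ck 1 setT a -> compactly_supported Omega a ->
  Ck 1 setT b -> compactly_supported (Omega `\` K) b ->
  (\int[leb]_(x in Omega)
     (u x * nl_adjoint Omega omega ord0 (tensor a b) x))%:E =
  (\int[leb \x leb]_z ('D_e0 u z.1 * (omega z * tensor a b z))%:E)%E.
Proof.
move=> C1u cK KO uK Ca sa Cb sb.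
have mO := open_measurable_rV oOmega.
have oO2 : open (Omega `*` Omega) by exact: openX.
have sbO : compactly_supported Omega b.
  by have [L [cL LO bL]] := sb; exists L; split=> // y /LO[].
have [L [cL LO2 tL]] := compactly_supported_tensor sa sbO.
pose H z := omega z * tensor a b z.
have CcT : C1c (Omega `*` Omega) (tensor a b).
  split; first exact: Ck_sub (Ck1_tensor Ca Cb).
  exact: compactly_supported_tensor.
have C1H : Cc1 H := C1c_Cc1 (C1c_mull oO2 Comega CcT).
have HL z : ~ L z -> H z = 0 by move=> /tL tz; rewrite /H tz mulr0.
have ccDH : Cc (fun z => - 'D_(e0, 0) H z).
  by case: C1H => _ _ /(_ (e0, 0))/Cc_opp.
pose G (z : V * V) := u z.1 * - 'D_(e0, 0) H z.
have ccG : Cc G.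
  apply: Cc_mull => // z.
  apply: (@continuous_comp _ _ _ (fst : V * V -> V) u); first exact: cvg_fst.
  by have [[cu _] _ _] := C1u; exact: cu.
rewrite -(integral2_by_parts C1u C1H) -/(G _).
have iG := integrable_Cc2 ccG.
suff XE : (\int[leb]_(x in Omega)
      (u x * nl_adjoint Omega omega ord0 (tensor a b) x)%:E
    = \int[leb \x leb]_z (G z)%:E)%E.
  by rewrite /Rintegral XE fineK//; exact: integrable_fin_num.
rewrite -(integral12_prod_meas1 iG) /fubini_F/= integral_mkcond.
apply: eq_integral => x _; rewrite patchE.
have [ux0|/eqP ux0] := eqVneq (u x) 0.
  rewrite [RHS]integral0_eq; last by move=> y _; rewrite /G/= ux0 mul0r.
  by case: ifP => _ //; rewrite ux0 mul0r.
have Kx : K x by apply: contrapT => /uK.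
rewrite ifT; last by rewrite inE; exact: KO.
have inner : (\int[leb]_(y in Omega) ('D_e0 (fun x' => omega (x', y) *
    (tensor a b (y, x') - tensor a b (x', y))) x)%:E =
    \int[leb]_y (- 'D_(e0, 0) H (x, y))%:E)%E.
  rewrite integral_mkcond; apply: eq_integral => y _; rewrite patchE.
  case: ifPn => [/set_mem Oy|/negP]; last first.
    rewrite inE => nOy; rewrite (derive_compact_support _ cL HL) ?oppr0//.
    by move=> /LO2[].
  congr (_%:E); rewrite (@near_eq_derive _ _ _ _ (- (fun x' => H (x', y)))).
    have [_ dHy _] := Cc1_slicel y C1H.
    by rewrite deriveN// derive_slicel.
  have [M [cM MO bM]] := sb.
  have nMx : ~ M x by move=> /MO[].
  near=> x'; have nMx' : ~ M x'.
    by near: x'; exact: (@near_notin_compact R V M x).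
  by rewrite /tensor/= (bM x')// mulr0 sub0r mulrN.
rewrite /nl_adjoint /Rintegral inner.
have iDH := integrable_Cc (Cc_slicer x ccDH).
rewrite EFinM fineK; last exact: integrable_fin_num.
rewrite -integralZl//; exact: eq_integral.
Unshelve. all: by end_near. Qed.

End nonlocal_estimate.

(** * Triviality of the two spaces *)

Section triviality.
Context {R : realType}.

Lemma lebesgue_rV_setD_compact n (U K : set 'rV[R]_n) : open U -> compact K ->
  lebesgue_rV R n U = +oo%E -> lebesgue_rV R n (U `\` K) = +oo%E.
Proof.
move=> oU cK Uoo.
have mU := open_measurable_rV oU.
have mK : measurable K.
  rewrite -(setCK K); apply: measurableC; apply: open_measurable_rV.
  by apply: closed_openC; exact: compact_closed.
have [M M0 KM] := compact_sub_ball cK.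
have UKoo : (lebesgue_rV R n (U `&` K) < +oo)%E.
  apply: le_lt_trans (lebesgue_rV_ball_lty (0 : 'rV[R]_n) M).
  apply: le_measure; rewrite ?inE.
  - exact: measurableI.
  - exact: measurable_ball_rV.
  - by move=> x [_ /KM].
apply/eqP; rewrite -leye_eq leNgt; apply/negP => UDoo.
have : (lebesgue_rV R n ((U `\` K) `|` (U `&` K)) < +oo)%E.
  apply: le_lt_trans (lte_add_pinfty UDoo UKoo).
  by apply: measureU2; [exact: measurableD|exact: measurableI].
by rewrite setUC setUIDK; have := Uoo => /= ->; rewrite ltxx.
Qed.

Section estimates.
Context {n : nat}.
Local Notation V := 'rV[R]_n.+1.
Local Notation leb := (lebesgue_rV R n.+1).
Local Notation e0 := (delta_mx ord0 ord0 : V).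
Variables (Omega : set V) (omega : V * V -> R).
Local Notation Omega2 := (Omega `*` Omega).

(** Here psi is [tensor a b] with a supported in the set where D u > d, and with
    b large on Omega minus the support of u; then k is c * d. The lower bound by
    a multiple of the integral of psi, rather than by a constant, is what the
    case of Sobolev functions requires. *)
Lemma large_test_functions (c : R) (u : V -> R) : open Omega ->
  leb Omega = +oo%E -> Ck 1 Omega2 omega -> 0 < c ->
  (forall x y, Omega x -> Omega y -> c <= omega (x, y)) ->
  C1c Omega u -> u != cst 0 ->
  exists2 k, 0 < k & forall T : R, exists psi : V * V -> R,
    [/\ C1c Omega2 psi, forall z, 0 <= psi z <= 1,
        (T%:E < \int[leb \x leb]_z (psi z)%:E)%E &
        (k%:E * \int[leb \x leb]_z (psi z)%:E <=
         (\int[leb]_(x in Omega)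
            (u x * nl_adjoint Omega omega ord0 psi x))%:E)%E].
Proof.
move=> oO Ooo Comega c0 comega Cu u0.
have C1u := C1c_Cc1 Cu; have [_ [K [cK KO uK]]] := Cu.
have [x0 Dx0] := exists_derive_gt0 C1u u0.
have [_ _ /(_ e0) ccDu] := C1u.
(* half the value at x0, so that D u > d persists in a neighbourhood *)
pose d := 'D_e0 u x0 / 2; have d0 : 0 < d by rewrite divr_gt0.
pose U := Omega `&` 'D_e0 u @^-1` [set t | d < t].
have oU : open U.
  apply: openI => //; apply: open_comp; last exact: open_gt.
  by move=> x _; exact: ccDu.1.
have Ux0 : U x0.
  split; last by rewrite /= ltr_pdivrMr// ltr_pMr// ltr1n.
  apply: contrapT => nOx0; have : 'D_e0 u x0 = 0.
    by apply: derive_compact_support cK uK _ => /KO.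
  by move=> D0; rewrite D0 ltxx in Dx0.
have [a [Ca sa a01 Ia]] := exists_bump oU Ux0.
have saO : compactly_supported Omega a.
  by have [L [cL LU aL]] := sa; exists L; split=> // x /LU[].
have cca : Cc a by have [] := C1c_Cc1 (conj (Ck_sub (fun _ _ => I) Ca) saO).
have aU x : ~ U x -> a x = 0.
  by have [L [cL LU aL]] := sa; move=> nUx; apply: aL => /LU.
have oOK : open (Omega `\` K).
  by apply: openI => //; apply: closed_openC; exact: compact_closed.
have OKoo := lebesgue_rV_setD_compact oO cK Ooo.
exists (c * d); first exact: mulr_gt0.
move=> T.
pose A := fine (\int[leb]_x (a x)%:E)%E.
have iA : (\int[leb]_x (a x)%:E)%E \is a fin_num.
  by apply: integrable_fin_num => //; exact: integrable_Cc.
have A0 : 0 < A by rewrite fine_gt0// Ia ltey_eq iA.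
have [b [Cb sb b01 Ib]] := exists_large_bump (T / A) oOK OKoo.
have sbO : compactly_supported Omega b.
  by have [L [cL LU bL]] := sb; exists L; split=> // x /LU[].
have bO x : ~ Omega x -> b x = 0.
  by have [L [cL LU bL]] := sbO; move=> nUx; apply: bL => /LU.
have ccb : Cc b by have [] := C1c_Cc1 (conj (Ck_sub (fun _ _ => I) Cb) sbO).
have Cab := Ck1_tensor Ca Cb.
have sab := compactly_supported_tensor saO sbO.
have CcT : C1c Omega2 (tensor a b) := conj (Ck_sub (fun _ _ => I) Cab) sab.
have ccT : Cc (tensor a b) by have [] := C1c_Cc1 CcT.
have T01 z : 0 <= tensor a b z <= 1.
  have /andP[? ?] := a01 z.1; have /andP[? ?] := b01 z.2.
  by rewrite /tensor mulr_ge0//= mulr_ile1.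
exists (tensor a b); split => //.
  rewrite integral_tensor// -(fineK iA) muleC -lte_pdivrMr//.
rewrite (integral_nl_adjoint oO Comega C1u cK KO uK Ca saO Cb sb).
have iT := integrable_Cc2 ccT.
rewrite -integralZl//; apply: le_integral => //.
- exact: integrableZl.
- have [ccH _ _] := C1c_Cc1 (C1c_mull (openX oO oO) Comega CcT).
  apply: integrable_Cc2; apply: Cc_mull ccH => z.
  apply: (@continuous_comp _ _ _ (fst : V * V -> V) ('D_e0 u)).
    exact: cvg_fst.
  exact: ccDu.1.
move=> z _; rewrite -EFinM lee_fin.
have /andP[t0 _] := T01 z.
have [tz|tz] := eqVneq (tensor a b z) 0; first by rewrite tz !mulr0.
have Uz : U z.1.
  by apply: contrapT => /aU az; rewrite /tensor az mul0r eqxx in tz.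
have Oz : Omega z.2.
  by apply: contrapT => /bO bz; rewrite /tensor bz mulr0 eqxx in tz.
(* on the support of psi, d < D u and c <= omega *)
rewrite [leRHS]mulrA ler_wpM2r// [leLHS]mulrC; apply: ler_pM.
- exact: ltW.
- exact: ltW.
- by apply: ltW; exact: Uz.2.
- by case: z {t0 tz} Uz Oz => x y [Ox _] Oy; exact: comega.
Qed.

End estimates.

Lemma enorm_ge0 n (v : 'rV[R]_n) : 0 <= enorm v.
Proof. exact: sqrtr_ge0. Qed.

Lemma coord_le_enorm n (v : 'rV[R]_n) i : `|v ord0 i| <= enorm v.
Proof.
rewrite -sqrtr_sqr /enorm ler_wsqrtr// (bigD1 i)//= lerDl.
by apply: sumr_ge0 => j _; exact: sqr_ge0.
Qed.

Lemma enorm_delta n (i : 'I_n) (s : R) :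
  enorm (s *: (delta_mx ord0 i : 'rV[R]_n)) = `|s|.
Proof.
rewrite /enorm (bigD1 i)//= big1 ?addr0.
  by rewrite !mxE !eqxx mulr1 sqrtr_sqr.
by move=> j /negbTE ji; rewrite !mxE ji andbF mulr0 expr0n.
Qed.

Lemma measurable_enorm n : measurable_fun setT (@enorm R n).
Proof.
apply: continuous_measurable_rV => v.
apply: (@continuous_comp _ _ _ (fun v : 'rV[R]_n => \sum_i v ord0 i ^+ 2)
  Num.sqrt).
  apply: (Ck1_continuous (U := setT)) => //; apply: Ck1_sum => [|i].
    exact: openT.
  exact: (Ck1_mul openT (Ck1_coord i) (Ck1_coord i)).
exact: sqrt_continuous.
Qed.

Lemma nl_adjoint_cst0 n (Omega : set 'rV[R]_n) omega i x :
  nl_adjoint Omega omega i (cst 0) x = 0.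
Proof.
rewrite /nl_adjoint /Rintegral integral0_eq// => y _; congr (_%:E).
rewrite (_ : (fun x' : 'rV[R]_n => _) = cst 0) ?derive_cst//.
by apply/funext => x'; rewrite subrr mulr0.
Qed.

Lemma nl_div_delta n (Omega : set 'rV[R]_n) omega (i : 'I_n) psi x :
  nl_div Omega omega (fun z => psi z *: (delta_mx ord0 i : 'rV[R]_n)) x
  = nl_adjoint Omega omega i psi x.
Proof.
have coordE j : (fun z => (psi z *: (delta_mx ord0 i : 'rV[R]_n)) ord0 j) =
    if j == i then psi else cst 0.
  apply/funext => z; rewrite !mxE /=.
  by case: (j == i); rewrite ?mulr1 ?mulr0.
rewrite /nl_div (bigD1 i)//= coordE eqxx big1 ?addr0// => j /negbTE ji.
by rewrite coordE ji nl_adjoint_cst0.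
Qed.

Section nontrivial.
Context {n : nat}.
Local Notation V := 'rV[R]_n.+1.
Local Notation leb := (lebesgue_rV R n.+1).
Variables (Omega : set V) (omega : V * V -> R) (c : R).
Local Notation Omega2 := (Omega `*` Omega).
Hypotheses (oO : open Omega) (Ooo : leb Omega = +oo%E)
  (Comega : Ck 1 Omega2 omega) (c0 : 0 < c)
  (comega : forall x y, Omega x -> Omega y -> c <= omega (x, y)).

(** The vector fields psi *: e0, with psi a large test function, make the
    supremum infinite. *)
Lemma NLBV_C1c_eq0 (u : V -> R) :
  C1c Omega u -> NLBV Omega omega u -> u = cst 0.
Proof.
move=> Cu [_ uoo]; apply/eqP; apply: contraTT uoo => u0.
have [k k0 large] := large_test_functions oO Ooo Comega c0 comega Cu u0.
suff : NLTV Omega omega u = +oo%E by move=> ->.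
apply/eqyP => M _.
have [psi [Cpsi psi01 Mpsi kpsi]] := large (M / k).
apply: (@le_trans _ _
  (\int[leb]_(x in Omega) (u x * nl_adjoint Omega omega ord0 psi x))%:E).
  apply: le_trans kpsi; rewrite muleC -lee_pdivrMr//; exact: ltW.
apply: ereal_sup_ubound.
exists (fun z => psi z *: (delta_mx ord0 ord0 : V)) => /=.
  have [Cpsi1 [K [cK KO psiK]]] := Cpsi; split.
    split; first by apply: Ck1_scalel => //; exact: openX.
    by exists K; split=> // z /psiK ->; rewrite scale0r.
  by move=> z; have /andP[? ?] := psi01 z; rewrite enorm_delta ger0_norm.
by congr (_%:E); apply: eq_Rintegral => x _; rewrite nl_div_delta.
Qed.

(** A substitute for Hoelder's inequality that treats p = 1 and p > 1 alike: if
    s <= t the first term dominates, and otherwise s = s ^ p * s ^ (1 - p) is at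
    most s ^ p * t ^ (1 - p). *)
Lemma mul_le_powR (p t s w : R) : 1 <= p -> 0 < t -> 0 <= s -> 0 <= w <= 1 ->
  s * w <= t * w + t `^ (1 - p) * s `^ p.
Proof.
move=> p1 t0 s0 /andP[w0 w1].
have [st|ts] := leP s t.
  by rewrite ler_wpDr ?ler_wpM2r// mulr_ge0// powR_ge0.
apply: (@le_trans _ _ s); first by rewrite ler_piMr.
rewrite -[leLHS]add0r lerD//; first by rewrite mulr_ge0// ltW.
have s_gt0 := lt_trans t0 ts.
have -> : t `^ (1 - p) = (t `^ (p - 1))^-1 by rewrite -powRN opprB.
rewrite mulrC ler_pdivlMr ?powR_gt0//.
have -> : s `^ p = s * s `^ (p - 1).
  by rewrite -[X in X * _](powRr1 s0) -powRD ?lt0r_neq0 ?implybT// addrC subrK.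
apply: ler_wpM2l => //; apply: ge0_ler_powR => //; last exact: ltW.
  by rewrite subr_ge0.
by rewrite nnegrE ltW.
Qed.

(** A large test function psi satisfies k * I <= t * I + t ^ (1 - p) * G,
    where I is its integral and G the integral of |g| ^ p. As t = k / 2, this
    contradicts the choice of I above t ^ (1 - p) * G / t. *)
Lemma W1p_C1c_eq0 p (u : V -> R) : 1 <= p ->
  C1c Omega u -> W1p Omega omega p u -> u = cst 0.
Proof.
move=> p1 Cu [_ [g /(_ ord0)[_ [mg _] ug] [mG Goo]]].
apply: contrapT => /eqP u0.
have [k k0 large] := large_test_functions oO Ooo Comega c0 comega Cu u0.
have mO := open_measurable_rV oO.
have mO2 : measurable Omega2 by exact: measurableX.
pose t := k / 2; have t0 : 0 < t by rewrite divr_gt0.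
set G := (X in (X < _)%E) in Goo.
have G0 : (0 <= G)%E by apply: integral_ge0 => z _; rewrite lee_fin powR_ge0.
have Gfin : G \is a fin_num by rewrite ge0_fin_numE.
have [psi [Cpsi psi01 Tpsi kpsi]] := large (t `^ (1 - p) * fine G / t).
have ccpsi : Cc psi by have [] := C1c_Cc1 Cpsi.
have psi0 z : 0 <= psi z by have /andP[] := psi01 z.
set I := (\int[leb \x leb]_z (psi z)%:E)%E in Tpsi kpsi.
have Ifin : I \is a fin_num.
  by apply: integrable_fin_num => //; exact: integrable_Cc2.
have mpsi : measurable_fun Omega2 psi.
  by apply: measurable_funTS; exact: continuous_measurable_rV2 ccpsi.1.
have IE : (\int[leb \x leb]_(z in Omega2) (psi z)%:E = I)%E.
  have [_ [K [_ KO psiK]]] := Cpsi.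
  rewrite integral_mkcond; apply: eq_integral => z _; rewrite patchE.
  by case: ifPn => // /negP; rewrite inE => nz; rewrite psiK// => /KO.
have menorm : measurable_fun Omega2 (fun z => enorm (g z) `^ p).
  apply: (measurableT_comp (@measurable_powR R p)).
  exact: (measurableT_comp (@measurable_enorm n.+1)).
have bound : (\int[leb \x leb]_(z in Omega2) `|(g z ord0 ord0 * psi z)%:E| <=
    t%:E * I + (t `^ (1 - p))%:E * G)%E.
  rewrite -IE -ge0_integralZl//; last 3 first.
  - exact/measurable_EFinP.
  - by move=> z _; rewrite lee_fin.
  - by rewrite lee_fin ltW.
  rewrite -ge0_integralZl//; last 3 first.
  - exact/measurable_EFinP.
  - by move=> z _; rewrite lee_fin powR_ge0.
  - by rewrite lee_fin powR_ge0.
  rewrite -ge0_integralD//; last 4 first.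
  - by move=> z _; rewrite -EFinM lee_fin mulr_ge0// ltW.
  - by apply: measurable_funeM; exact/measurable_EFinP.
  - by move=> z _; rewrite -EFinM lee_fin mulr_ge0// powR_ge0.
  - by apply: measurable_funeM; exact/measurable_EFinP.
  apply: ge0_le_integral => //.
  - apply: measurableT_comp => //; apply/measurable_EFinP.
    exact: measurable_funM.
  - by apply: emeasurable_funD; apply: measurable_funeM; exact/measurable_EFinP.
  move=> z _; rewrite -!EFinM -EFinD lee_fin normrM (ger0_norm (psi0 z)).
  apply: le_trans (mul_le_powR p1 t0 (normr_ge0 _) (psi01 z)) _.
  rewrite lerD2l ler_wpM2l ?powR_ge0// ge0_ler_powR ?nnegrE ?enorm_ge0//.
    by rewrite (le_trans _ p1).
  exact: coord_le_enorm.
have ig : (leb \x leb)%E.-integrable Omega2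
    (EFin \o (fun z => g z ord0 ord0 * psi z)).
  apply/integrableP; split.
    by apply/measurable_EFinP; exact: measurable_funM.
  apply: le_lt_trans bound _.
  by rewrite -(fineK Ifin) -(fineK Gfin) -!EFinM -EFinD ltry.
move: kpsi; rewrite (ug _ Cpsi); apply/negP; rewrite -ltNge.
apply: (@le_lt_trans _ _ (t%:E * I + (t `^ (1 - p))%:E * G)%E).
  apply: le_trans bound; apply: le_trans (le_abse_integral _ mO2 _); last first.
    by case/integrableP: ig.
  rewrite -EFin_normr_Rintegral// lee_fin -normrN; exact: ler_norm.
move: Tpsi; rewrite -(fineK Ifin) -(fineK Gfin) -!EFinM -EFinD !lte_fin/=.
rewrite ltr_pdivrMr// => Tpsi.
suff -> : k * fine I = t * fine I + fine I * t by rewrite ltrD2l.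
by rewrite /t; lra.
Qed.

End nontrivial.

Lemma Cc_infty_C1c n (U : set 'rV[R]_n) (u : 'rV[R]_n -> R) :
  Cc_infty U u -> C1c U u.
Proof. by case=> /(_ 1%N). Qed.

Section zero.
Context {n : nat} (Omega : set 'rV[R]_n) (omega : 'rV[R]_n * 'rV[R]_n -> R).

Lemma Cc_infty0 : Cc_infty Omega (fun=> 0 : R).
Proof.
split; first by move=> k; exact: Ck_cst.
by exists set0; split=> //; exact: compact0.
Qed.

Lemma NLBV0 : NLBV Omega omega (fun=> 0).
Proof.
split; first exact: integrable0.
apply: (@le_lt_trans _ _ 0%E); last by rewrite ltry.
apply: ge_ereal_sup => _ [phi _ <-]; rewrite lee_fin.
by rewrite /Rintegral integral0_eq// => x _; rewrite mul0r.
Qed.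

Lemma W1p0 p : 1 <= p -> W1p Omega omega p (fun=> 0).
Proof.
move=> p1; have p0 : p != 0 by rewrite gt_eqF// (lt_le_trans ltr01).
split.
  split; first exact: measurable_cst.
  by rewrite integral0_eq ?ltry// => x _; rewrite normr0 powR0.
exists (fun=> 0); last first.
  split; first exact: measurable_cst.
  rewrite integral0_eq ?ltry// => x _; rewrite /enorm big1 ?sqrtr0 ?powR0//.
  by move=> i _; rewrite mxE expr0n.
move=> i; split.
- by split; [exact: measurable_cst|move=> K _ _; exact: integrable0].
- split; first by under eq_fun do rewrite mxE; exact: measurable_cst.
  by move=> K _ _; under eq_fun do rewrite /= mxE; exact: integrable0.
- move=> psi _.
  rewrite /Rintegral integral0_eq/= => [|x _]; last by rewrite mul0r.
  by rewrite integral0_eq ?oppr0// => x _; rewrite mxE mul0r.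
Qed.

End zero.

End triviality.

Theorem corollary1p5 (R : realType) (N : nat) (Omega : set 'rV[R]_N) (p : R)
    (omega : 'rV[R]_N * 'rV[R]_N -> R) :
  open Omega -> Omega !=set0 -> lebesgue_rV R N Omega = +oo%E ->
  1 <= p ->
  admissible_weight Omega omega ->
  (exists2 c : R, 0 < c &
     forall x y, Omega x -> Omega y -> c <= omega (x, y)) ->
  Cc_infty Omega `&` W1p Omega omega p = Cc_infty Omega `&` NLBV Omega omega /\
  Cc_infty Omega `&` NLBV Omega omega = [set (fun=> 0)].
Proof.
case: N Omega omega => [|n] Omega omega oO _ Ooo p1 [_ Comega _] [c c0 comega].
  by move: Ooo; rewrite /= diracE => -[].
suff -> : Cc_infty Omega `&` W1p Omega omega p = [set (fun=> 0)].
  suff -> : Cc_infty Omega `&` NLBV Omega omega = [set (fun=> 0)] by [].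
  apply/seteqP; split=> [u [/Cc_infty_C1c Cu Nu]|_ ->].
    exact: (NLBV_C1c_eq0 oO Ooo Comega c0 comega Cu Nu).
  by split; [exact: Cc_infty0|exact: NLBV0].
apply/seteqP; split=> [u [/Cc_infty_C1c Cu Wu]|_ ->].
  exact: (W1p_C1c_eq0 oO Ooo Comega c0 comega p1 Cu Wu).
by split; [exact: Cc_infty0|exact: W1p0].
Qed.
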